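(* Let $N_1,N_2>1$ be integers and let $K$ be a differential field of characteristic $0$ with derivation $D$. Let $F$ be a differential field extension of $K$. Let $L_1(Y)$ and $L_2(Y)$ be nonzero homogeneous linear differential polynomials, of orders $N_1$ and $N_2$ respectively, with coefficients in $K$. Let $y\in F$ be nonzero, and suppose that one of the following holds: (1) $L_1(y)=L_2(1/y)=0$; (2) $q$ is a positive integer with $N_2\le q$, and $L_1(y)=L_2(y^q)=0$. Then for each $j=1,\dots,N_1-1$, the element $D^jy/y$ is a root of a nonzero polynomial with coefficients in $K$ of degree at most $$\binom{N_2+N_1-2}{N_1-1}$$ in case (1), and of degree at most $$\binom{q(N_1-1)+N_1-2}{N_1-1}$$ in case (2).
   Context: A differential field is a field with a single derivation $D$; a differential field extension $F$ of $K$ is a field extension with a derivation on $F$ extending that of $K$, also denoted $D$. A homogeneous linear differential polynomial of order $N$ over $K$ is an expression $L(Y)=c_ND^NY+c_{N-1}D^{N-1}Y+\cdots+c_1DY+c_0Y$ with $c_i\in K$ and $c_N\ne0$; $L(y)$ denotes its value at $Y=y$. *)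

(* Defs.v *)
From mathcomp Require Import all_boot all_order all_algebra.

Set Implicit Arguments.
Unset Strict Implicit.
Unset Printing Implicit Defensive.

Import GRing.Theory.
Local Open Scope ring_scope.

(* The library's [Derivation] (field/separable.v) only covers derivations that
   are linear over the base field of a finite-dimensional extension, so it does
   not apply to arbitrary differential fields. *)
Definition is_derivation (R : pzRingType) (D : R -> R) : Prop :=
  {morph D : x y / x + y} /\ (forall x y, D (x * y) = D x * y + x * D y).

Record diff_field_ext (K F : fieldType) (DK : K -> K) (DF : F -> F)
    (iota : {rmorphism K -> F}) : Prop := DiffFieldExt {
  derivation_base : is_derivation DK;
  derivation_ext : is_derivation DF;
  derivation_compat : forall a, DF (iota a) = iota (DK a)
}.

(* Homogeneous linear differential polynomials of order exactly N, given by
   their coefficients c_0, ..., c_N. *)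
Record ldpoly (K : fieldType) (N : nat) := LDPoly {
  ldcoef : 'I_N.+1 -> K;
  ldcoef_lead : ldcoef ord_max != 0
}.

Definition ldeval (K F : fieldType) (DF : F -> F) (iota : {rmorphism K -> F})
    (N : nat) (L : ldpoly K N) (y : F) : F :=
  \sum_(i < N.+1) iota (ldcoef L i) * iter i DF y.

(* [size p <= d.+1] says that p has degree at most d. *)
Definition root_of_degree_le (K F : fieldType) (iota : {rmorphism K -> F})
    (d : nat) (z : F) : Prop :=
  exists p : {poly K},
    [/\ p != 0, (size p <= d.+1)%N & root (map_poly iota p) z].

(* Main.v *)
Require Import Defs.
From mathcomp Require Import all_boot all_order all_fingroup all_algebra.
From mathcomp Require Import zify.
Import GRing.Theory.
Local Open Scope ring_scope.

Set Implicit Arguments.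
Unset Strict Implicit.
Unset Printing Implicit Defensive.

(** Write Y_a = D^a y / a! and let W be the K-span of the Y_a. Since L1(y) = 0,
    W is already spanned by Y_0, ..., Y_n with n = N1 - 1. For every m, let W^m
    be the K-span of the products of m elements of W; it is spanned by the
    monomials of degree m in Y_0, ..., Y_n, of which there are 'C(m + n, n).
    Everything reduces to one inclusion, W^(m+1) <= y W^m: multiplication by
    D^j y / y then maps the nonzero finite-dimensional space W^m to itself, so
    that D^j y / y is an eigenvalue of a matrix over K of size 'C(m + n, n), and
    its characteristic polynomial is the required polynomial
    ([root_of_monomial_straightening]). The inclusion is needed for
    m = N2 - 1 in case (1) and for m = q n - 1 in case (2).

    The inclusion comes from weights, where Y_a has weight a. Modulo monomials of
    lower weight the formal series Y(t) = \sum_a Y_a t^a behaves like a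
    polynomial of degree n, and the second equation says that 1/Y(t),
    respectively Y(t)^q, behaves like a polynomial of degree less than N2.

    In case (1) the weight-homogeneous picture is the cohomology ring of a
    Grassmannian: Y_1, ..., Y_n are elementary symmetric functions, the
    coefficients of 1/Y(t) are complete ones (up to sign) and vanish from degree
    N2 on, and Jacobi-Trudi determinants rewrite each monomial of degree N2 in
    terms of those that contain Y_0. The filtered version of that determinant is
    as follows. Write the coefficients of 1/Y(t) as W_m = \sum_(k < N2) phi_mk W_k
    with phi_mk in K. For exponents e_0, ..., e_(N2-1), let C_jk be the
    coefficient of t^(e_j) in Y(t) \sum_m phi_mk t^m. Then \sum_k C_jk W_k is the
    coefficient of t^(e_j) in 1, hence 0 or 1, and Cramer's rule puts
    \det C in y W^(N2-1) ([det_mem]). For e_j = s_j + j with s nondecreasing, the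
    diagonal of C contributes the monomial Y_(s_0) ... Y_(s_(N2-1)), and all
    other terms have lower weight or have the same weight and are more spread
    out ([reciprocal_straighten]).

    In case (2), a monomial of degree q n in Y_1, ..., Y_n contains some Y_i at
    least q times. The coefficient of t^(q i) in Y(t)^q is Y_i^q plus products
    of q factors with the same weight that are more spread out, and it is a
    K-combination of coefficients of lower weight because q i >= q >= N2
    ([power_straighten]). *)

(** * Linear spans over the base field *)

Section Subspaces.
Variables (K F : fieldType) (iota : {rmorphism K -> F}).

(** F is not given as a K-module but through the embedding [iota], so that
    K-subspaces are encoded as predicates. *)
Record subspace (T : F -> Prop) : Prop := Subspace {
  subspace0 : T 0;
  subspaceD : forall x z, T x -> T z -> T (x + z);
  subspaceZ : forall a x, T x -> T (iota a * x)
}.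

Definition lin_span (I : finType) (v : I -> F) (x : F) : Prop :=
  exists c : I -> K, x = \sum_i iota (c i) * v i.

Lemma lin_span_subspace (I : finType) (v : I -> F) : subspace (lin_span v).
Proof.
split.
- by exists (fun=> 0); rewrite big1 // => i _; rewrite rmorph0 mul0r.
- move=> _ _ [c ->] [d ->]; exists (fun i => c i + d i).
  by rewrite -big_split; apply: eq_bigr => i _; rewrite rmorphD mulrDl.
- move=> a _ [c ->]; exists (fun i => a * c i); rewrite mulr_sumr.
  by apply: eq_bigr => i _; rewrite rmorphM mulrA.
Qed.

Lemma mem_lin_span (I : finType) (v : I -> F) i : lin_span v (v i).
Proof.
exists (fun j => (j == i)%:R); rewrite (bigD1 i) //= eqxx rmorph1 mul1r.
by rewrite big1 ?addr0 // => j /negPf->; rewrite rmorph0 mul0r.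
Qed.

Lemma subspace_div (T : F -> Prop) (y : F) :
  subspace T -> subspace (fun x => T (x / y)).
Proof.
case=> T0 TD TZ; split=> [|x z Tx Tz|a x Tx].
- by rewrite mul0r.
- by rewrite mulrDl; apply: TD.
- by rewrite -mulrA; apply: TZ.
Qed.

Variables (T : F -> Prop) (hT : subspace T).

Lemma subspace_sum (I : Type) (r : seq I) (P : pred I) (G : I -> F) :
  (forall i, P i -> T (G i)) -> T (\sum_(i <- r | P i) G i).
Proof. by move=> TG; elim/big_ind: _ => //; case: hT. Qed.

Lemma subspaceN x : T x -> T (- x).
Proof. by move=> Tx; rewrite -mulN1r -(rmorphN1 iota); apply: subspaceZ. Qed.

Lemma subspaceB x z : T x -> T z -> T (x - z).
Proof. by move=> Tx Tz; apply: subspaceD => //; apply: subspaceN. Qed.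

(** Expanding a product of K-linear combinations leaves only the terms whose
    K-coefficient is nonzero; the straightening arguments read off from that
    nonvanishing which monomials can occur. *)
Lemma subspace_prod_sum (I J : finType) (c : I -> J -> K) (v : I -> J -> F) z :
  (forall f : {ffun I -> J},
    \prod_i c i (f i) != 0 -> T (z * \prod_i v i (f i))) ->
  T (z * \prod_i \sum_j iota (c i j) * v i j).
Proof.
move=> Tv; rewrite bigA_distr_bigA mulr_sumr; apply: subspace_sum => f _.
rewrite big_split /= mulrCA -rmorph_prod.
have [->|/Tv] := eqVneq (\prod_i c i (f i)) 0; last exact: subspaceZ.
by rewrite rmorph0 mul0r; apply: subspace0.
Qed.

End Subspaces.

(** * Monomials and the straightening order *)

Section Monomials.
Variables (R : comPzRingType) (Y : nat -> R).

Definition monomial (s : seq nat) : R := \prod_(a <- s) Y a.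

Definition weight (s : seq nat) : nat := \sum_(a <- s) a.

(** A base larger than the number of entries lets one large entry dominate
    all the smaller ones together, so that raising the largest entry that
    changes increases the spread. *)
Definition spread (s : seq nat) : nat := \sum_(a <- s) (size s).+1 ^ a.

(** The order of rewriting: towards lower weight and, at equal weight, towards
    more spread-out exponents. *)
Definition below (s' s : seq nat) : bool :=
  (weight s' < weight s)%N ||
  (weight s' == weight s) && (spread s < spread s')%N.

(** The order is well founded in fixed degree because the spread is bounded in
    terms of the degree and the weight. *)
Lemma below_ind p (P : seq nat -> Prop) :
  (forall s, size s = p ->
    (forall s', size s' = p -> below s' s -> P s') -> P s) ->
  forall s, size s = p -> P s.
Proof.
move=> IH s; move Ew: (weight s) => w.
elim/ltn_ind: w s Ew => w IHw s.
move Em: (p * p.+1 ^ w - spread s)%N => m.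
elim/ltn_ind: m s Em => m IHm s Em Ew sz; apply: IH => // s' sz'.
case/orP=> [lt|/andP[/eqP ew lt]].
  by apply: IHw (erefl _) sz'; rewrite -Ew.
apply: (IHm _ _ s' erefl) => //; last by rewrite ew.
have le: (spread s' <= p * p.+1 ^ w)%N.
  rewrite /spread sz' -[X in (_ <= X * _)%N]sz' -count_predT -sum1_count big_distrl /= big_seq.
  rewrite [leqRHS]big_seq; apply: leq_sum => a sa.
  rewrite mul1n leq_pexp2l // -Ew -ew /weight (big_rem a) //=.
  exact: leq_addr.
by rewrite -Em; lia.
Qed.

Lemma monomial_perm s s' : perm_eq s s' -> monomial s = monomial s'.
Proof. exact: perm_big. Qed.

Lemma below_perm s s' t t' :
  perm_eq s s' -> perm_eq t t' -> below s t = below s' t'.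
Proof.
move=> ps pt; have e u u' : perm_eq u u' ->
  (weight u = weight u') * (spread u = spread u').
  by move=> pu; rewrite /weight /spread (perm_size pu) !(perm_big _ pu).
by rewrite /below !(e _ _ ps) !(e _ _ pt).
Qed.

Lemma monomial_codom (I : finType) (f : I -> nat) :
  monomial (codom f) = \prod_i Y (f i).
Proof. by rewrite /monomial /codom /image_mem big_map enumT. Qed.

Lemma weight_codom (I : finType) (f : I -> nat) :
  weight (codom f) = (\sum_i f i)%N.
Proof. by rewrite /weight /codom /image_mem big_map enumT. Qed.

Lemma spread_codom (I : finType) (f : I -> nat) :
  spread (codom f) = (\sum_i #|I|.+1 ^ f i)%N.
Proof. by rewrite /spread size_codom /codom /image_mem big_map enumT. Qed.

Lemma monomial_cons a s : monomial (a :: s) = Y a * monomial s.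
Proof. exact: big_cons. Qed.

Lemma monomial_cat s t : monomial (s ++ t) = monomial s * monomial t.
Proof. exact: big_cat. Qed.

Lemma weight_cat s t : weight (s ++ t) = (weight s + weight t)%N.
Proof. exact: big_cat. Qed.

Lemma codom_nth d s : size s = d -> s = codom (fun j : 'I_d => nth 0%N s j).
Proof.
move=> sz; apply: (@eq_from_nth _ 0%N); first by rewrite size_codom card_ord.
move=> i; rewrite sz => lti.
by rewrite /codom /image_mem (nth_map (Ordinal lti)) -?enumT ?size_enum_ord //
   ?nth_enum_ord.
Qed.
(** The non-diagonal terms of a Jacobi-Trudi determinant: beyond the largest
    index moved by [sigma] the exponents agree, and at that index [sigma]
    decreases, so that the exponent jumps above all the remaining ones. *)
Lemma below_shifted_perm d (s f : 'I_d -> nat) (sigma : 'S_d) :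
  (forall i j : 'I_d, (i <= j)%N -> (s i <= s j)%N) ->
  (forall j, f j + sigma j = s j + j)%N -> sigma != 1%g ->
  below (codom f) (codom s).
Proof.
move=> smono e ne1; apply/orP; right.
rewrite !weight_codom !spread_codom card_ord.
have -> : (\sum_i f i = \sum_i s i)%N.
  apply/eqP; rewrite -(eqn_add2r (\sum_(i < d) i)).
  rewrite [X in (_ + X == _)%N](reindex_inj (@perm_inj _ sigma)) -!big_split /=.
  by apply/eqP/eq_bigr => j _; apply: e.
rewrite eqxx /=.
have [j0 Hj0]: exists j, sigma j != j.
  apply/existsP; apply: contraR ne1; rewrite negb_exists => /forallP h.
  by apply/eqP/permP=> j; rewrite perm1; apply/eqP; have := h j; rewrite negbK.
(* The largest index moved by sigma. *)
pose j := [arg max_(j > j0 | sigma j != j) val j].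
have [Hj max] : sigma j != j /\ forall k : 'I_d, (j < k)%N -> sigma k = k.
  rewrite /j; case: arg_maxnP => // {}j Hj mx; split=> // k ltk.
  by apply/eqP; apply: contraTT ltk => /mx; rewrite -leqNgt.
have lt : (sigma j < j)%N.
  rewrite ltn_neqAle Hj /= leqNgt; apply/negP => /max /perm_inj ej.
  by rewrite ej eqxx in Hj.
have fj : (s j < f j)%N by have := e j; lia.
have fk (k : 'I_d) : (j < k)%N -> f k = s k.
  by move=> /max ek; have := e k; rewrite ek; lia.
rewrite (bigID (fun k : 'I_d => (j < k)%N)) [ltnRHS](bigID (fun k : 'I_d => (j < k)%N)) /=.
rewrite (eq_bigr (fun k => d.+1 ^ f k)%N) => [|k /fk->//].
rewrite ltn_add2l.
apply: (@leq_trans (d.+1 ^ f j)); last first.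
  by rewrite (bigD1 j) ?ltnn //= leq_addr.
apply: (@leq_trans (d.+1 ^ (s j).+1)); last by rewrite leq_pexp2l.
apply: (@leq_ltn_trans (d * d.+1 ^ s j)%N); last first.
  by rewrite expnS ltn_pmul2r // expn_gt0.
apply: (@leq_trans (\sum_(i < d | ~~ (j < i)%N) d.+1 ^ s j)%N).
  by apply: leq_sum => k; rewrite -leqNgt => /smono; apply: leq_pexp2l.
rewrite sum_nat_const leq_mul2r; apply/orP; right.
by rewrite -[leqRHS]card_ord max_card.
Qed.

End Monomials.

(** * Straightening when the reciprocal series has finite rank *)

Section Reciprocal.
Variables (K F : fieldType) (iota : {rmorphism K -> F}).
Variables (T : F -> Prop) (hT : subspace iota T) (Y : nat -> F).
Variables (d : nat) (W : nat -> F).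
Hypothesis YW : forall e, \sum_(a < e.+1) Y a * W (e - a)%N = (e == 0)%:R.
Hypothesis W_span :
  forall m, lin_span iota (fun k : 'I_d.+1 => W k) (W m).
Hypothesis T_Y0 : forall s, size s = d -> T (Y 0 * monomial Y s).

(** The coordinates of the W_m are chosen to be the trivial ones for m <= d; the
    choice has to respect the weight, which is the condition k <= m on the
    nonzero ones. Only indices below a bound matter, so that finitely many
    choices suffice. *)
Lemma triangular_coordinates B : exists phi : nat -> 'I_d.+1 -> K,
  (forall m, (m < B)%N -> W m = \sum_k iota (phi m k) * W k) /\
  (forall m k, phi m k != 0 -> (k <= m)%N) /\
  (forall k : 'I_d.+1, phi k k = 1).
Proof.
have /fin_all_exists[c cE] (m : 'I_B) := W_span m.
exists (fun m (k : 'I_d.+1) => if (m <= d)%N then (m == k)%:R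
                   else if insub m is Some m' then c m' k else 0).
split=> [m ltB|]; last split=> [m k|k].
- case: leqP => [le|_]; last by rewrite insubT /= -cE.
  rewrite (bigD1 (inord m)) //= inordK // eqxx rmorph1 mul1r big1 ?addr0 // => k.
  rewrite -val_eqE /= inordK // eq_sym => /negPf->.
  by rewrite rmorph0 mul0r.
- case: leqP => [_|lt _]; last by rewrite ltnW // (leq_trans (ltn_ord k)).
  by have [->|_] := eqVneq m k; rewrite ?leqnn ?eqxx.
- by rewrite -ltnS ltn_ord eqxx.
Qed.

(** Cramer's rule: solving C W = (e_j == 0)_j for W_0 = 1 / Y_0 expresses
    \det C as Y_0 times a sum of maximal minors of C without its first column,
    and these are products of d combinations of the Y_a. *)
Lemma det_mem (C : 'M[F]_d.+1) (e : 'I_d.+1 -> nat) B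
    (c : 'I_d.+1 -> 'I_d.+1 -> 'I_B -> K) :
  (forall j k, C j k = \sum_(a < B) iota (c j k a) * Y a) ->
  (forall j, \sum_k C j k * W k = (e j == 0)%:R) ->
  T (\det C).
Proof.
move=> CE Ce.
have Y0W0 : Y 0 * W 0 = 1 by have := YW 0; rewrite big_ord1 subnn.
have dC : \det C * W 0 = \sum_j \adj C ord0 j * (e j == 0)%:R.
  pose w : 'cV[F]_d.+1 := \col_k W k.
  transitivity ((\adj C *m (C *m w)) ord0 ord0).
    by rewrite mulmxA mul_adj_mx mul_scalar_mx !mxE.
  rewrite mxE; apply: eq_bigr => j _; congr (_ * _); rewrite mxE -Ce.
  by apply: eq_bigr => k _; rewrite mxE.
have -> : \det C = Y 0 * (\det C * W 0) by rewrite mulrCA Y0W0 mulr1.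
rewrite dC mulr_sumr; apply: (subspace_sum hT) => j _.
case: (e j == 0)%N; last by rewrite !mulr0; case: hT.
rewrite mulr1 !mxE /cofactor mulrCA -signr_odd mulr_sign.
set x := Y 0 * _; suff Tx : T x by case: ifP => // _; apply: (subspaceN hT).
rewrite /x mulr_sumr; apply: (subspace_sum hT) => s _.
rewrite mulrCA mulr_sign.
set z := Y 0 * _; suff Tz : T z by case: ifP => // _; apply: (subspaceN hT).
rewrite /z; under eq_bigr => i _ do rewrite !mxE CE.
apply: (subspace_prod_sum hT) => f _.
by rewrite -(monomial_codom Y (fun i => f i)); apply: T_Y0; rewrite size_codom card_ord.
Qed.

(** Induction along [below]: the monomial of a sorted [s] is the diagonal term
    of the determinant with row exponents s_j + j. *)
Lemma reciprocal_straighten s : size s = d.+1 -> T (monomial Y s).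
Proof.
move: s; apply: below_ind => s sz IH.
pose r := sort leq s.
have prs : perm_eq r s by rewrite perm_sort.
have szr : size r = d.+1 by rewrite size_sort.
rewrite -(monomial_perm Y prs).
have {}IH t : size t = d.+1 -> below t r -> T (monomial Y t).
  by move=> szt; rewrite (below_perm (perm_refl t) prs); apply: IH.
pose g (j : 'I_d.+1) := nth 0%N r j.
have gmono (i j : 'I_d.+1) : (i <= j)%N -> (g i <= g j)%N.
  move=> le; apply: (sorted_leq_nth leq_trans leqnn) => //.
  - exact: sort_sorted leq_total _.
  - by rewrite inE szr.
  - by rewrite inE szr.
have rE : r = codom g by apply: codom_nth.
(* Row exponents that put Y_(g j) on the diagonal of the determinant. *)
rewrite rE in IH *; pose e (j : 'I_d.+1) := (g j + j)%N.
pose B := (\max_j e j).+1.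
have eB j : (e j < B)%N by rewrite ltnS leq_bigmax.
have [phi [phiE [phi_tri phi1]]] := triangular_coordinates B.
pose c j k (a : 'I_B) := if (a <= e j)%N then phi (e j - a)%N k else 0.
pose C : 'M[F]_d.+1 := \matrix_(j, k) \sum_(a < B) iota (c j k a) * Y a.
have : T (\det C).
  apply: (@det_mem C e B c) => [j k|j]; first by rewrite mxE.
  rewrite -YW (big_ord_widen B (fun a => Y a * W (e j - a)%N)) // [RHS]big_mkcond /=.
  under eq_bigr => k _ do rewrite mxE mulr_suml.
  rewrite exchange_big /=; apply: eq_bigr => a _; rewrite /c ltnS.
  case: leqP => le; last by rewrite big1 // => k _; rewrite rmorph0 !mul0r.
  rewrite phiE ?(leq_ltn_trans (leq_subr _ _)) // mulr_sumr.
  by apply: eq_bigr => k _; rewrite mulrCA mulrA.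
have c_shift j k a : c j k a != 0 ->
    (a + k <= e j)%N.
  rewrite /c; case: leqP => [le /phi_tri|_]; last by rewrite eqxx.
  by lia.
(* A term of the expansion has weight at most that of g; when the weights agree,
   it is the diagonal term or comes from a nontrivial permutation. *)
have other (sigma : 'S_d.+1) (f : {ffun 'I_d.+1 -> 'I_B}) :
    \prod_j c j (sigma j) (f j) != 0 ->
    (sigma != 1%g) || [exists j, (f j != g j :> nat)] -> T (\prod_j Y (f j)).
  move=> nz ne; rewrite -(monomial_codom Y (fun j => f j)).
  apply: IH; first by rewrite size_codom card_ord.
  have le j : (f j + sigma j <= e j)%N.
    have : c j (sigma j) (f j) != 0.
      by apply: contraNneq nz => z; rewrite (bigD1 j) //= z mul0r.
    exact: c_shift.
  have [eq|] := boolP [forall j, f j + sigma j == e j]%N.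
    have {}eq j := eqP (forallP eq j).
    apply: (below_shifted_perm gmono eq).
    apply: contraL ne => /eqP s1; rewrite s1 eqxx negb_exists /=.
    apply/forallP => j; rewrite negbK; have := eq j.
    by rewrite s1 perm1 /e => /eqP; rewrite eqn_add2r.
  rewrite negb_forall => /existsP[j ne_j].
  apply/orP; left; rewrite !weight_codom.
  rewrite -(ltn_add2r (\sum_(i < d.+1) i)).
  rewrite [X in (_ + X < _)%N](reindex_inj (@perm_inj _ sigma)) -!big_split /=.
  rewrite (bigD1 j) //= [ltnRHS](bigD1 j) //= -addSn leq_add //.
    by rewrite ltn_neqAle ne_j le.
  by apply: leq_sum => k _; apply: le.
pose g' : {ffun 'I_d.+1 -> 'I_B} := [ffun j => inord (g j)].
have g'E j : g' j = g j :> nat.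
  by rewrite ffunE inordK // (leq_ltn_trans _ (eB j)) // leq_addr.
rewrite /determinant (bigD1 1%g) //= odd_perm1 mul1r.
under eq_bigr => j _ do rewrite perm1 mxE.
rewrite bigA_distr_bigA (bigD1 g') //= -addrA.
have -> : \prod_j (iota (c j j (g' j)) * Y (g' j)) = monomial Y (codom g).
  rewrite monomial_codom; apply: eq_bigr => j _.
  by rewrite /c g'E leq_addr addKn phi1 rmorph1 mul1r.
set rest := (X in _ + X) => Tall.
suff Trest : T rest.
  by have := subspaceB hT Tall Trest; rewrite addrK.
apply: (subspaceD hT).
- apply: (subspace_sum hT) => f ne; rewrite big_split /= -rmorph_prod.
  have [->|nz] := eqVneq (\prod_j c j j (f j)) 0.
    by rewrite rmorph0 mul0r; case: hT.
  apply: (subspaceZ hT); apply: (other 1%g); rewrite ?eqxx.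
    by under eq_bigr => j _ do rewrite perm1.
  apply: contraR ne; rewrite negb_exists => /forallP fg.
  by apply/eqP/ffunP => j; apply: val_inj; rewrite /= g'E; apply/eqP; rewrite -[_ == _]negbK.
- apply: (subspace_sum hT) => sigma ne; rewrite mulr_sign; set x := \prod_j _.
  suff Tx : T x by case: ifP => // _; apply: (subspaceN hT).
  rewrite /x -[x in T x]mul1r; under eq_bigr => j _ do rewrite mxE.
  by apply: (subspace_prod_sum hT) => f nz; rewrite mul1r; apply: other nz _; rewrite ne.
Qed.
End Reciprocal.

(** * Straightening when a power of the series has finite rank *)

Section Power.
Variables (K F : fieldType) (iota : {rmorphism K -> F}).
Variables (T : F -> Prop) (hT : subspace iota T) (Y : nat -> F).

(** Among the exponents with a given sum, the constant ones are the least spread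
    out, because any others contain an entry above the mean. *)
Lemma below_constant_block q i (f : 'I_q -> nat) r :
  (\sum_j f j = q * i)%N -> (exists j, f j != i) ->
  below (codom f ++ r) (nseq q i ++ r).
Proof.
move=> fq [j0 ne]; apply/orP; right.
have [j1 lt] : exists j, (i < f j)%N.
  apply/existsP; apply: contraLR isT; rewrite negb_exists => /forallP le.
  suff : (\sum_j f j < \sum_(j < q) i)%N.
    by rewrite fq sum_nat_const card_ord ltnn.
  rewrite (bigD1 j0) //= [ltnRHS](bigD1 j0) //= -addSn leq_add //.
    by rewrite ltn_neqAle ne leqNgt le.
  by apply: leq_sum => j _; rewrite leqNgt le.
rewrite !weight_cat weight_codom fq /weight big_nseq iter_addn_0 mulnC eqxx /=.
rewrite /spread !size_cat size_codom card_ord size_nseq !big_cat /=.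
rewrite ltn_add2r big_nseq iter_addn_0; set p := (q + _).+1.
rewrite /codom /image_mem big_map big_enum /= (bigD1 j1) //=.
apply: leq_trans (leq_addr _ _); apply: leq_trans (leq_pexp2l _ lt) => //.
by rewrite expnS mulnC ltn_pmul2r ?expn_gt0 // ltnS leq_addr.
Qed.

Lemma frequent_entry q n s : (0 < q)%N -> size s = (q * n)%N -> (0 < n)%N ->
  all (fun a => 0 < a <= n)%N s -> exists2 i, (0 < i)%N & (q <= count_mem i s)%N.
Proof.
move=> q0 sz n0 sn.
suff [i ge] : exists i : 'I_n, (q <= count_mem i.+1 s)%N by exists i.+1.
apply/existsP; apply: contraLR isT; rewrite negb_exists => /forallP lt.
have : (size s <= \sum_(i < n) count_mem i.+1 s)%N.
  elim: s sn {sz lt} => //= a s IH /andP[/andP[a0 an] /IH {}IH].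
  rewrite big_split /=; have la : (a.-1 < n)%N by lia.
  rewrite -add1n leq_add // (bigD1 (Ordinal la)) //= prednK //.
  by rewrite eqxx.
have : (\sum_(i < n) count_mem i.+1 s <= \sum_(i < n) q.-1)%N.
  by apply: leq_sum => i _; have := lt i; lia.
rewrite sum_nat_const card_ord sz; nia.
Qed.

Lemma split_count i q (s : seq nat) : (q <= count_mem i s)%N ->
  exists r, perm_eq s (nseq q i ++ r).
Proof.
elim: q s => [|q IH] s le; first by exists s.
have si : i \in s by rewrite -has_pred1 has_count; lia.
have [|r pr] := IH (rem i s); first by rewrite count_rem si /= eqxx subn1 -ltnS (ltn_predK le).
by exists r; apply: perm_trans (perm_to_rem si) _; rewrite /= perm_cons.
Qed.

(** The coefficient of t^e in the q-th power of the series \sum_a Y_a t^a. *)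
Definition power_coef q e : F :=
  \sum_(f : {ffun 'I_q -> 'I_e.+1} | (\sum_j f j == e)%N) \prod_j Y (f j).

(** Induction along [below]: entries above [n] are replaced by smaller ones, and
    once all entries lie in 1, ..., n, some entry i occurs q times by the
    pigeonhole principle; the block Y_i^q is then eliminated by means of the
    coefficient of t^(q i). *)
Lemma power_straighten q n N m :
  (0 < n)%N -> (0 < q)%N -> (N <= q)%N -> m.+1 = (q * n)%N ->
  (forall a, lin_span iota (fun k : 'I_n.+1 => Y k) (Y a)) ->
  (forall e, lin_span iota (fun k : 'I_N => power_coef q k) (power_coef q e)) ->
  (forall s, size s = m -> T (Y 0 * monomial Y s)) ->
  forall s, size s = (q * n)%N -> T (monomial Y s).
Proof.
move=> n0 q0 leNq mE Y_span P_span T_Y0; apply: below_ind => s sz IH.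
have [sn|] := boolP (all (leq^~ n) s); last first.
  case/allPn => a sa; rewrite -ltnNge => lt.
  have ps := perm_to_rem sa; rewrite (monomial_perm Y ps) monomial_cons.
  have [c ->] := Y_span a; rewrite mulr_suml.
  apply: (subspace_sum hT) => k _; rewrite -mulrA; apply: (subspaceZ hT).
  rewrite -monomial_cons; apply: IH.
    by rewrite /= -sz (perm_size ps).
  rewrite (below_perm (perm_refl _) ps); apply/orP; left.
  by rewrite /weight !big_cons ltn_add2r (leq_trans (ltn_ord k)).
have [s0|s0] := boolP (0%N \in s).
  have ps := perm_to_rem s0; rewrite (monomial_perm Y ps) monomial_cons.
  by apply: T_Y0; rewrite size_rem // sz -mE.
have [i i0 /split_count[r ps]] : exists2 i, (0 < i)%N & (q <= count_mem i s)%N.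
  apply: (frequent_entry q0 sz n0); apply/allP => a sa.
  rewrite (allP sn a sa) andbT lt0n; apply: contraNneq s0 => <-; exact: sa.
have szr : size r = (q * n - q)%N.
  by rewrite -sz (perm_size ps) size_cat size_nseq addKn.
have lower f : size f = q -> below (f ++ r) (nseq q i ++ r) ->
    T (monomial Y f * monomial Y r).
  move=> szf lt; rewrite -monomial_cat; apply: IH.
    by rewrite size_cat szf szr subnKC // leq_pmulr.
  by rewrite (below_perm (perm_refl _) ps).
have Tall : T (power_coef q (q * i) * monomial Y r).
  have [c ->] := P_span (q * i)%N; rewrite mulr_suml.
  apply: (subspace_sum hT) => k _; rewrite -mulrA; apply: (subspaceZ hT).
  rewrite mulr_suml; apply: (subspace_sum hT) => f /eqP fk.
  rewrite -(monomial_codom Y (fun j => f j)); apply: lower.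
    by rewrite size_codom card_ord.
  apply/orP; left; rewrite !weight_cat ltn_add2r weight_codom fk.
  rewrite /weight big_nseq iter_addn_0 (leq_trans (ltn_ord k)) //.
  by rewrite mulnC (leq_trans leNq) // leq_pmulr.
have iB : (i < (q * i).+1)%N by rewrite ltnS leq_pmull.
pose f0 : {ffun 'I_q -> 'I_(q * i).+1} := [ffun=> Ordinal iB].
move: Tall; rewrite /power_coef (bigD1 f0) /=; last first.
  by under eq_bigr => j _ do rewrite ffunE /=; rewrite sum_nat_const card_ord.
have -> : \prod_j Y (f0 j) = monomial Y (nseq q i).
  under eq_bigr => j _ do rewrite ffunE /=.
  by rewrite /monomial big_nseq iter_mulr_1 prodr_const card_ord.
rewrite mulrDl -monomial_cat -(monomial_perm Y ps).
set rest := (X in _ + X) => Tall; suff Trest : T rest.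
  by have := subspaceB hT Tall Trest; rewrite addrK.
rewrite /rest mulr_suml; apply: (subspace_sum hT) => f /andP[/eqP fi ne].
rewrite -(monomial_codom Y (fun j => f j)); apply: lower.
  by rewrite size_codom card_ord.
apply: below_constant_block => //; apply/existsP.
apply: contraR ne; rewrite negb_exists => /forallP fE.
by apply/eqP/ffunP => j; apply/val_inj/eqP; have := fE j; rewrite negbK ffunE.
Qed.
End Power.

(** * Divided derivatives *)

Section DividedDerivatives.
Variables (F : fieldType) (D : F -> F).
Hypotheses (hD : is_derivation D) (charF : [pchar F] =i pred0).

(** Dividing by factorials turns Leibniz' rule into the Cauchy product of
    Taylor series. *)
Definition divided_deriv a (x : F) : F := iter a D x / a`!%:R.

Local Notation hd := divided_deriv.

Lemma derivD x z : D (x + z) = D x + D z. Proof. by case: hD. Qed.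

Lemma derivM x z : D (x * z) = D x * z + x * D z. Proof. by case: hD. Qed.

Lemma deriv0 : D 0 = 0.
Proof. by apply: (addrI (D 0)); rewrite -derivD !addr0. Qed.

Lemma deriv1 : D 1 = 0.
Proof.
apply: (addrI (D 1)).
by rewrite -{1}(mulr1 (D 1)) -{2}(mul1r (D 1)) -derivM mulr1 addr0.
Qed.

Lemma deriv_sum (I : Type) (r : seq I) (P : pred I) (G : I -> F) :
  D (\sum_(i <- r | P i) G i) = \sum_(i <- r | P i) D (G i).
Proof. exact: (big_morph D derivD deriv0). Qed.

Lemma deriv_nat n : D n%:R = 0.
Proof.
elim: n => [|n IH]; first exact: deriv0.
by rewrite -addn1 natrD derivD IH deriv1 addr0.
Qed.

Lemma natr_neq0 n : (0 < n)%N -> n%:R != 0 :> F.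
Proof. by move=> n0; rewrite (pcharf0P F).1 // -lt0n. Qed.

Lemma deriv_div_nat x n : (0 < n)%N -> D (x / n%:R) = D x / n%:R.
Proof.
move=> n0; apply: (mulIf (natr_neq0 n0)); rewrite divfK ?natr_neq0 //.
by rewrite -[in RHS](divfK (natr_neq0 n0) x) [RHS]derivM deriv_nat mulr0 addr0.
Qed.

Lemma divided_deriv0 x : hd 0 x = x.
Proof. by rewrite /hd divr1. Qed.

Lemma deriv_divided_deriv a x : D (hd a x) = a.+1%:R * hd a.+1 x.
Proof.
rewrite /hd deriv_div_nat ?fact_gt0 // factS natrM iterS.
rewrite invfM mulrCA; congr (_ * _).
by rewrite mulVKf // natr_neq0.
Qed.

Lemma iter_divided_deriv a x : iter a D x = a`!%:R * hd a x.
Proof. by rewrite mulrC divfK // natr_neq0 // fact_gt0. Qed.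

Lemma divided_deriv_1 e : hd e 1 = (e == 0)%:R.
Proof.
case: e => [|e]; first by rewrite divided_deriv0.
suff De : iter e.+1 D 1 = 0 by rewrite /hd De mul0r.
by elim: e => [|e IH]; [apply: deriv1 | rewrite iterS IH deriv0].
Qed.

Lemma divided_derivM e x z :
  hd e (x * z) = \sum_(a < e.+1) hd a x * hd (e - a)%N z.
Proof.
elim: e => [|e IH]; first by rewrite big_ord1 !divided_deriv0.
apply: (mulfI (natr_neq0 (ltn0Sn e))).
rewrite -deriv_divided_deriv IH deriv_sum.
under eq_bigr => a _ do rewrite derivM !deriv_divided_deriv.
rewrite big_split /=.
(* Both sums extend to all a <= e + 1: their coefficients, a and e + 1 - a,
   vanish at the end term that is missing. *)
transitivity (\sum_(a < e.+2) a%:R * (hd a x * hd (e.+1 - a)%N z)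
     + \sum_(a < e.+2) (e.+1 - a)%N%:R * (hd a x * hd (e.+1 - a)%N z)).
  congr (_ + _).
    rewrite [RHS]big_ord_recl mul0r add0r.
    by apply: eq_bigr => a _; rewrite lift0 subSS mulrA.
  rewrite [RHS]big_ord_recr /= subnn mul0r addr0.
  by apply: eq_bigr => a _; rewrite -subSn 1?mulrCA // -ltnS.
rewrite -big_split mulr_sumr /=; apply: eq_bigr => a _.
by rewrite -mulrDl -natrD subnKC // -ltnS.
Qed.

Lemma coef_taylor_exp B y q e : (e < B)%N ->
  ((\poly_(a < B) hd a y) ^+ q)`_e = hd e (y ^+ q).
Proof.
elim: q e => [|q IH] e lt; first by rewrite coef1 divided_deriv_1.
rewrite !exprS coefM divided_derivM; apply: eq_bigr => a _.
by rewrite coef_poly (leq_trans (ltn_ord a)) // IH // (leq_ltn_trans (leq_subr _ _)).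
Qed.

Lemma power_coef_divided_deriv y q e :
  power_coef (fun a => hd a y) q e = hd e (y ^+ q).
Proof.
rewrite -(@coef_taylor_exp e.+1) // poly_def.
have -> (p : {poly F}) : p ^+ q = \prod_(j < q) p.
  by rewrite prodr_const card_ord.
rewrite bigA_distr_bigA coef_sum /power_coef big_mkcond.
apply: eq_bigr => f _ /=.
have -> : \prod_(j < q) (hd (f j) y *: 'X^(f j)) =
    (\prod_j hd (f j) y) *: 'X^(\sum_j f j) :> {poly F}.
  rewrite -prodrXr -scaler_prod //.
by rewrite coefZ coefXn eq_sym; case: eqP; rewrite ?mulr1 ?mulr0.
Qed.
End DividedDerivatives.

Section SolutionSpan.
Variables (K F : fieldType) (DK : K -> K) (DF : F -> F).
Variable iota : {rmorphism K -> F}.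
Hypotheses (hKF : diff_field_ext DK DF iota) (charF : [pchar F] =i pred0).

Local Notation hd := (divided_deriv DF).

(** The span of the first N divided derivatives is stable under the derivation
    since the equation rewrites the N-th one. *)
Lemma divided_deriv_span N (L : ldpoly K N) x m : ldeval DF iota L x = 0 ->
  lin_span iota (fun k : 'I_N => hd k x) (hd m x).
Proof.
have hD := derivation_ext hKF.
move=> Lx; set S := lin_span _ _; have hS : subspace iota S by apply: lin_span_subspace.
have Sk k : (k <= N)%N -> S (hd k x).
  rewrite leq_eqVlt => /predU1P[->|lt]; last exact: (mem_lin_span _ _ (Ordinal lt)).
  have nz : iota (ldcoef L ord_max) * N`!%:R != 0.
    by rewrite mulf_neq0 ?fmorph_eq0 ?ldcoef_lead // natr_neq0 // fact_gt0.
  move: Lx; rewrite /ldeval big_ord_recr /= => /(canRL (addKr _)).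
  rewrite addr0 (iter_divided_deriv _ charF) mulrA => /(canRL (mulKf nz)) ->.
  rewrite -(rmorph_nat iota) -rmorphM -fmorphV; apply: (subspaceZ hS).
  apply: (subspaceN hS); apply: (subspace_sum hS) => k0 _; apply: (subspaceZ hS).
  rewrite (iter_divided_deriv _ charF) -(rmorph_nat iota); apply: (subspaceZ hS).
  exact: (mem_lin_span iota (fun k : 'I_N => hd k x)).
elim: m => [|m [c IH]]; first exact: Sk.
have nz := natr_neq0 charF (ltn0Sn m).
have -> : hd m.+1 x = iota (m.+1%:R^-1) * DF (hd m x).
  by rewrite (deriv_divided_deriv hD charF) fmorphV rmorph_nat mulKf.
apply: (subspaceZ hS); rewrite IH (deriv_sum hD); apply: (subspace_sum hS) => k _.
rewrite (derivM hD) (derivation_compat hKF) (deriv_divided_deriv hD charF).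
apply: (subspaceD hS); apply: (subspaceZ hS); first by apply/Sk/ltnW.
by rewrite -(rmorph_nat iota); apply: (subspaceZ hS); apply: Sk.
Qed.
End SolutionSpan.

(** * Degree bounds from stable spans *)

Section Degree.
Variables (K F : fieldType) (iota : {rmorphism K -> F}).

(** The relations say that v is an eigenvector, with eigenvalue z, of a matrix
    over K, whose characteristic polynomial therefore vanishes at z. *)
Lemma root_of_stable_span (I : finType) (v : I -> F) (z : F) :
  (exists i, v i != 0) -> (forall i, lin_span iota v (z * v i)) ->
  root_of_degree_le iota #|I| z.
Proof.
move=> [i0 nz] /fin_all_exists[c cE].
pose A : 'M[K]_#|I| := \matrix_(i, j) c (enum_val j) (enum_val i).
exists (char_poly A); split.
- exact/monic_neq0/char_poly_monic.
- by rewrite size_char_poly.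
rewrite map_char_poly -eigenvalue_root_char; apply/eigenvalueP.
exists (\row_i v (enum_val i)).
  apply/rowP => j; rewrite !mxE cE [RHS](reindex_onto enum_val enum_rank) /=; last first.
    by move=> i _; rewrite enum_rankK.
  by apply: eq_big => [i|i _]; rewrite ?enum_valK ?eqxx // !mxE mulrC.
apply: contraNneq nz => /rowP/(_ (enum_rank i0)).
by rewrite !mxE enum_rankK => ->.
Qed.

(** Sorted tuples index the monomials of degree m in n + 1 variables without
    repetition, which is what makes the count a binomial coefficient. *)
Definition sorted_tuple m n :=
  {t : m.-tuple 'I_n.+1 | sorted leq (map val t)}.

Variable Y : nat -> F.

Definition sorted_monomial m n (t : sorted_tuple m n) : F :=
  monomial Y (map val (val t)).

Lemma monomial_span m n s :
  (forall a, lin_span iota (fun k : 'I_n.+1 => Y k) (Y a)) ->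
  size s = m -> lin_span iota (@sorted_monomial m n) (monomial Y s).
Proof.
move=> Y_span sz; have hS := lin_span_subspace iota (@sorted_monomial m n).
rewrite (codom_nth sz) monomial_codom.
have /fin_all_exists[c cE] (j : 'I_m) := Y_span (nth 0%N s j).
under eq_bigr => j _ do rewrite cE.
rewrite -[X in lin_span _ _ X]mul1r; apply: (subspace_prod_sum hS) => f _.
rewrite mul1r -(monomial_codom Y (fun j => f j)).
pose le (a b : 'I_n.+1) := (a <= b)%N.
have srt : sorted leq (map val (sort_tuple le [tuple f j | j < m])).
  by rewrite sorted_map; apply: sort_sorted => a b; apply: leq_total.
rewrite (_ : monomial _ _ = sorted_monomial (Sub (sort_tuple le _) srt : sorted_tuple m n)).
  exact: mem_lin_span.
apply: monomial_perm.
have -> : codom (fun j => f j : nat) = map val [tuple f j | j < m].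
  by rewrite /= -map_comp.
by rewrite perm_map // perm_sym perm_sort.
Qed.

Lemma card_sorted_tuple m n : #|{: sorted_tuple m n}| = 'C(m + n, n).
Proof.
rewrite -(bin_sub (leq_addl _ _)) addnK -card_sorted_tuples.
by rewrite card_sig cardsE.
Qed.

(** With W^m the span of the monomials of degree m, the hypothesis is
    W^(m+1) <= Y_0 W^m, so that W^m is stable under multiplication by
    Y_j / Y_0. *)
Lemma root_of_monomial_straightening m n x j c :
  Y 0 != 0 -> (forall s, size s = m.+1 ->
     lin_span iota (@sorted_monomial m n) (monomial Y s / Y 0)) ->
  x = iota c * Y j -> root_of_degree_le iota 'C(m + n, n) (x / Y 0).
Proof.
move=> Y0 straight ->; rewrite -card_sorted_tuple.
have hS := lin_span_subspace iota (@sorted_monomial m n).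
apply: (root_of_stable_span (v := @sorted_monomial m n)) => [|t].
  have srt : sorted leq (map val (nseq_tuple m (ord0 : 'I_n.+1))).
    by rewrite map_nseq; case: (m) => //= k; elim: k.
  exists (Sub (nseq_tuple m ord0) srt : sorted_tuple m n).
  rewrite /sorted_monomial /= map_nseq /monomial big_nseq iter_mulr_1.
  by rewrite expf_neq0.
rewrite -!mulrA; apply: (subspaceZ hS).
rewrite /sorted_monomial (mulrC (Y 0)^-1) mulrA -monomial_cons.
by apply: straight; rewrite /= size_map size_tuple.
Qed.
End Degree.

(** * The degree bounds *)

Theorem theorem3p1 (N1 N2 : nat) (hN1 : (1 < N1)%N) (hN2 : (1 < N2)%N)
    (K F : fieldType) (DK : K -> K) (DF : F -> F) (iota : {rmorphism K -> F})
    (hKF : diff_field_ext DK DF iota) (hchar : [pchar K] =i pred0)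
    (L1 : ldpoly K N1) (L2 : ldpoly K N2) (y : F) (hy : y != 0) :
  (ldeval DF iota L1 y = 0 -> ldeval DF iota L2 y^-1 = 0 ->
   forall j : nat, (1 <= j <= N1 - 1)%N ->
   root_of_degree_le iota 'C(N2 + N1 - 2, N1 - 1) (iter j DF y / y))
  /\
  (forall q : nat, (0 < q)%N -> (N2 <= q)%N ->
   ldeval DF iota L1 y = 0 -> ldeval DF iota L2 (y ^+ q) = 0 ->
   forall j : nat, (1 <= j <= N1 - 1)%N ->
   root_of_degree_le iota 'C(q * (N1 - 1) + N1 - 2, N1 - 1) (iter j DF y / y)).
Proof.
have charF : [pchar F] =i pred0 by move=> p; rewrite (fmorph_pchar iota).
have hD := derivation_ext hKF.
case: N1 hN1 L1 => [|n] // n0 L1; case: N2 hN2 L2 => [|d] // d0 L2.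
pose Y a := divided_deriv DF a y.
have Y0 : Y 0 = y by apply: divided_deriv0.
have iterE j : iter j DF y = iota j`!%:R * Y j.
  by rewrite rmorph_nat (iter_divided_deriv _ charF).
(* The products that contain the factor Y_0 = y lie in y W^m. *)
have T_Y0 m s : (forall a, lin_span iota (fun k : 'I_n.+1 => Y k) (Y a)) ->
  size s = m ->
  lin_span iota (@sorted_monomial F Y m n) (Y 0 * monomial Y s / Y 0).
  by move=> Ysp sz; rewrite Y0 mulrAC divff // mul1r; apply: monomial_span.
split=> [L1y L2y j _|q q0 leq L1y L2y j _].
- have Y_span a := divided_deriv_span hKF charF a L1y.
  have -> : 'C(d.+1 + n.+1 - 2, n.+1 - 1) = 'C(d + n, n).
    by congr 'C(_, _); lia.
  rewrite -{2}Y0; apply: (root_of_monomial_straightening (m := d) _ _ (iterE j)).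
    by rewrite Y0.
  move=> s; apply: (reciprocal_straighten
    (subspace_div (Y 0) (lin_span_subspace iota _))
    (W := fun a => divided_deriv DF a y^-1)) => [e|m|{}s sz]; last exact: T_Y0.
    by rewrite -(divided_derivM hD charF) divff // (divided_deriv_1 hD).
  exact: (divided_deriv_span hKF charF m L2y).
- have Y_span a := divided_deriv_span hKF charF a L1y.
  have -> : 'C(q * (n.+1 - 1) + n.+1 - 2, n.+1 - 1) = 'C((q * n).-1 + n, n).
    by congr 'C(_, _); nia.
  have qn : (q * n).-1.+1 = (q * n)%N by rewrite prednK // muln_gt0 q0.
  rewrite -{2}Y0; apply: (root_of_monomial_straightening _ _ (iterE j)).
    by rewrite Y0.
  rewrite qn; apply: (power_straighten
    (subspace_div (Y 0) (lin_span_subspace iota _)) n0 q0 leq qn Y_span) => [e|s sz].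
    have [c cE] := divided_deriv_span hKF charF e L2y.
    exists c; rewrite (power_coef_divided_deriv hD charF) cE.
    by apply: eq_bigr => k _; rewrite (power_coef_divided_deriv hD charF).
  exact: T_Y0.
Qed.
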